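(* Let $\beta>0$, let $B\in\mathbb{R}^{n\times n}$ be a symmetric irreducible nonsingular $M$-matrix, and let $\lambda_{min}(B)<a<\lambda_*<b$, where $\lambda_*$ is the eigenvalue of a positive eigenpair $(u_*,\lambda_* )$ of $\beta\,\mathrm{diag}(u^{[2]})u+Bu=\lambda u$, $u^Tu=1$. For $\lambda>\lambda_{min}(B)$ let $u(\lambda)$ denote the unique entrywise positive solution of $\beta\,\mathrm{diag}(u^{[2]})u+Bu=\lambda u$. Let $p>0$ be an eigenvector of $B$ for $\lambda_{min}(B)$ and let $u_0=\alpha p$ with $\alpha>0$ so large that $$u_0>u(b)\ \text{(entrywise)},\qquad \min_{1\le i\le n}\beta(\alpha p_i)^2>b-\lambda_{min}(B).$$ Let $\lambda_k\in(a,b)$ be the value of $\lambda$ at the $k$-th bisection iteration of the Newton-Bisection Iteration started from the interval $[a,b]$, let $u_k^*=u(\lambda_k)$, let $r_k(u)=\beta\,\mathrm{diag}(u^{[2]})u+Bu-\lambda_ku$, and let $\{u_k^l\}_{l\ge0}$ be the Newton sequence defined by $u_k^0=u_0$ and $$\big[3\beta\,\mathrm{diag}((u_k^l)^{[2]})+B-\lambda_kI\big]u_k^{l+1}=2\beta\,\mathrm{diag}((u_k^l)^{[2]})u_k^l,\qquad l=0,1,2,\dots$$ Then there is a constant $M_1>0$, determined by $u_0$ and $u_k^*$ (for the given problem data, and independent of $l$), such that with $$\eta=\frac{4\beta^2\min(u_k^* )^4}{M_1},\qquad l_0=\left\lceil\frac{\big(\lambda_{max}(B)+3\beta\max(u_0^{[2]})-\lambda_k\big)\,\|u_0-u_k^*\|_1}{\eta}\right\rceil,$$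 one has, for every $l>l_0$, $$\|r_k(u_k^{l+1})\|\le\frac{M_1}{8\beta^2\min(u_k^* )^4}\,\|r_k(u_k^l)\|^2 .$$
   Context: For $u=[u_1,\dots,u_n]^T\in\mathbb{R}^n$: $u^{[2]}=[u_1^2,\dots,u_n^2]^T$, $\mathrm{diag}(u)$ is the diagonal matrix with diagonal $u$, $\min(u)=\min_iu_i$, $\max(u)=\max_iu_i$, $\min(u)^4=(\min_iu_i)^4$, $\|u\|$ is the Euclidean norm, $\|u\|_1$ the 1-norm, and inequalities between vectors are entrywise. $\lambda_{min}(B)$ and $\lambda_{max}(B)$ are the smallest and largest eigenvalues of $B$. A matrix $B$ is an $M$-matrix if $B=sI-A$ with $A$ entrywise nonnegative and $s\ge\rho(A)$ (spectral radius). $B$ is irreducible if there is no nonempty proper subset $I\subset\{1,\dots,n\}$ with $b_{ij}=0$ for all $i\in I,\ j\notin I$. A positive eigenpair is a solution $(u,\lambda)$ with $u>0$ entrywise. Known facts (Choi et al.): for each $\lambda>\lambda_{min}(B)$ the equation $\beta\,\mathrm{diag}(u^{[2]})u+Bu=\lambda u$ has a unique entrywise positive solution $u(\lambda)$, which is entrywise strictly increasing and continuous in $\lambda$. Moreover, for fixed $\lambda>\lambda_{min}(B)$, if $u_0=\alpha p$ satisfies $u_0>u(\lambda)$ and $\min_i\beta(\alpha p_i)^2>\lambda-\lambda_{min}(B)$, then the Newton iteration $[3\beta\,\mathrm{diag}((u^l)^{[2]})+B-\lambda I]u^{l+1}=2\beta\,\mathrm{diag}((u^l)^{[2]})u^l$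 started at $u^0=u_0$ is well defined and converges monotonically to $u(\lambda)$: $u(\lambda)<\cdots<u^2<u^1<u_0$. Newton-Bisection Iteration: at the $k$-th bisection iteration $\lambda_k$ is the midpoint of the current subinterval of $[a,b]$ (initially $[a,b]$ itself), and the equation $\beta\,\mathrm{diag}(u^{[2]})u+Bu=\lambda_ku$ is solved by the Newton iteration $[3\beta\,\mathrm{diag}((u_k^l)^{[2]})+B-\lambda_kI]u_k^{l+1}=2\beta\,\mathrm{diag}((u_k^l)^{[2]})u_k^l$, $l=0,1,2,\dots$, started from $u_k^0=u_0$, giving $u_k$; if $\|u_k\|>1$ the right endpoint of the current interval is replaced by $\lambda_k$, otherwise the left endpoint is. *)

(* Defs.v *)
From HB Require Import structures.
From mathcomp Require Import all_boot all_order all_algebra.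
From mathcomp Require Import all_classical all_reals all_analysis.
From mathcomp Require Import complex.

Set Implicit Arguments.
Unset Strict Implicit.
Unset Printing Implicit Defensive.

Import Order.TTheory GRing.Theory Num.Theory.
Import numFieldNormedType.Exports.

Local Open Scope classical_set_scope.
Local Open Scope ring_scope.

(* Dimensions are n.+1, so that vectors are nonempty and vmin, vmax below are
   a genuine minimum and maximum. *)
Section Vectors.
Variables (R : realType) (n : nat).
Implicit Types u v : 'cV[R]_n.+1.

Definition vsq u : 'cV[R]_n.+1 := \col_i (u i 0 ^+ 2).

Definition diagv u : 'M[R]_n.+1 := diag_mx u^T.

Definition vlt u v : Prop := forall i, u i 0 < v i 0.

Definition vmin u : R := \big[Num.min/u ord0 0]_i u i 0.

Definition vmax u : R := \big[Num.max/u ord0 0]_i u i 0.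

Definition norm1 u : R := \sum_i `|u i 0|.

(* The library's norm on matrices is the max norm, hence this definition. *)
Definition norm2 u : R := Num.sqrt (\sum_i u i 0 ^+ 2).

End Vectors.

Section Matrices.
Variables (R : realType) (n : nat).
Implicit Types A B : 'M[R]_n.+1.

(* The library's eigenvalue is about row eigenvectors; a matrix and its
   transpose have the same eigenvalues. For symmetric B the set below is
   finite and nonempty, so the infimum and supremum are attained. *)
Definition lambda_min B : R := inf [set x | eigenvalue B x].

Definition lambda_max B : R := sup [set x | eigenvalue B x].

Definition spectral_radius A : R :=
  sup [set r : R | exists2 z : R[i],
         eigenvalue (map_mx (real_complex R) A) z & `|z| = r%:C%C].

(* Singular M-matrices are included (s = spectral_radius A is allowed). *)
Definition M_matrix B : Prop :=
  exists s : R, exists A : 'M[R]_n.+1,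
    [/\ forall i j, 0 <= A i j, spectral_radius A <= s & B = s%:M - A].

Definition irreducible_mx B : Prop :=
  ~ exists I : {set 'I_n.+1},
      [/\ I != finset.set0, I != [set: 'I_n.+1]%SET &
          forall i j, i \in I -> j \notin I -> B i j = 0].

End Matrices.

Section Equation.
Variables (R : realType) (n : nat) (beta : R) (B : 'M[R]_n.+1).
Implicit Types (lam : R) (u : 'cV[R]_n.+1).

Definition residual lam u : 'cV[R]_n.+1 :=
  beta *: (diagv (vsq u) *m u) + B *m u - lam *: u.

Definition positive_solution lam u : Prop :=
  vlt 0 u /\ beta *: (diagv (vsq u) *m u) + B *m u = lam *: u.

Definition positive_eigenpair u lam : Prop :=
  positive_solution lam u /\ u^T *m u = 1%:M.

(* u(lambda): the positive solution, which exists and is unique when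
   lam > lambda_min B; the default value 0 is irrelevant in that range. *)
Definition pos_sol lam : 'cV[R]_n.+1 := xget 0 [set u | positive_solution lam u].

Definition newton_seq lam (u0 : 'cV[R]_n.+1) (U : nat -> 'cV[R]_n.+1) : Prop :=
  U 0%N = u0 /\
  forall l : nat,
    ((3 * beta) *: diagv (vsq (U l)) + B - lam%:M) *m U l.+1
    = (2 * beta) *: (diagv (vsq (U l)) *m U l).

(* A run of the Newton-Bisection Iteration from [a, b].  At step k the current
   interval is [left k, right k], its midpoint is lam k, U k is the Newton
   sequence at lam k started from u0, and w k is the solution it delivers,
   i.e. its limit. *)
Definition newton_bisection (u0 : 'cV[R]_n.+1) (a b : R)
    (left right lam : nat -> R)
    (U : nat -> nat -> 'cV[R]_n.+1) (w : nat -> 'cV[R]_n.+1) : Prop :=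
  [/\ left 0%N = a /\ right 0%N = b,
      forall k, lam k = (left k + right k) / 2,
      forall k, newton_seq (lam k) u0 (U k),
      forall k, U k l @[l --> \oo] --> w k &
      forall k, (left k.+1, right k.+1) =
        if 1 < norm2 (w k) then (left k, lam k) else (lam k, right k)].

End Equation.

(* Main.v *)
Require Import Defs.
From HB Require Import structures.
From mathcomp Require Import all_boot all_order all_algebra.
From mathcomp Require Import all_classical all_reals all_analysis.
From mathcomp Require Import ring lra.

Set Implicit Arguments.
Unset Strict Implicit.
Unset Printing Implicit Defensive.

Import Order.TTheory GRing.Theory Num.Theory.
Local Open Scope ring_scope.

(** The constant is M1 = 6 beta max(u0).  Write
    f(u) = beta u^3 + B u - lambda u (powers taken entrywise) for the residual
    and J(u) for its Jacobian.

    Since f is a cubic acting entrywise plus a linear map, Taylor's formula at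
    a Newton step u -> u' is exact: with d = u - u',
      J(u) d = f(u)   and   f(u') = beta d^2 (2 u + u')   (entrywise).
    So if 0 < u, u' <= K entrywise, then |f(u')| <= 3 beta K |d|^2, and it remains
    to bound |d| by |f(u)|, that is, to bound J(u) below.  Let us = u(lambda)
    and m = min(us).  The symmetric matrix beta diag(us^2) + B - lambda I has
    nonpositive off-diagonal entries and annihilates the positive vector us,
    so it is positive semidefinite; hence J(u) >= 2 beta m^2 I whenever
    u >= us.  Then |d| <= |f(u)| / (2 beta m^2), and altogether
      |f(u')| <= 3 beta K / (4 beta^2 m^4) |f(u)|^2,
    which is the claim when K = max(u0) (newton_residual_quadratic).

    Two facts about the iterates remain: us <= u_l <= u0, and us is a genuine
    positive solution.  Both come from the monotonicity of matrices with
    nonpositive off-diagonal entries that map some positive vector to a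
    positive one.  It shows that Newton's method preserves the properties u > 0
    and f(u) >= 0 and decreases u (newton_seq_invariant), and it gives a
    comparison principle: a positive subsolution lies below every positive
    supersolution (comparison).  The starting vector u0 = alpha p is a
    supersolution because beta (alpha p_i)^2 > b - lambda_min(B).  Existence of
    a positive solution follows from the convergence of the Newton sequence:
    its limit solves the equation, and it is positive because the sequence
    stays above a small positive multiple of p, which is a subsolution when
    lambda > lambda_min(B). *)

(** * Matrices with nonpositive off-diagonal entries *)

Definition Z_matrix (R : realType) (n : nat) (A : 'M[R]_n.+1) : Prop :=
  forall i j, i != j -> A i j <= 0.

Lemma Z_matrix_of_M_matrix (R : realType) (n : nat) (B : 'M[R]_n.+1) :
  M_matrix B -> Z_matrix B.
Proof.
case=> s [A [A_ge0 _ ->]] i j ij.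
by rewrite !mxE (negbTE ij) mulr0n sub0r oppr_le0.
Qed.

Lemma Z_matrix_mulmx_le (R : realType) (n : nat) (A : 'M[R]_n.+1)
    (x y : 'cV[R]_n.+1) i :
  Z_matrix A -> (forall j, x j 0 <= y j 0) -> x i 0 = y i 0 ->
  (A *m y) i 0 <= (A *m x) i 0.
Proof.
move=> ZA xy xyi; rewrite !mxE; apply: ler_sum => j _.
have [<-|ij] := eqVneq i j; first by rewrite xyi.
by rewrite ler_wnM2l ?ZA ?xy.
Qed.

(** Maximum principle.  The index is one where y_j / x_j attains its minimum
    t: there y touches t x from above, so the off-diagonal signs force A y
    below t (A x).  The two monotonicity lemmas read off the sign of t. *)
Lemma Z_matrix_min_ratio (R : realType) (n : nat) (A : 'M[R]_n.+1)
    (x y : 'cV[R]_n.+1) :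
  Z_matrix A -> vlt 0 x ->
  exists i t, [/\ y i 0 = t * x i 0, forall j, t * x j 0 <= y j 0
                & (A *m y) i 0 <= t * (A *m x) i 0].
Proof.
move=> ZA x0.
have x_gt0 j : 0 < x j 0 by have := x0 j; rewrite mxE.
case: (@Order.TotalTheory.arg_minP _ _ _ ord0 predT
  (fun j => y j 0 / x j 0) isT) => i _ imin.
have yi : y i 0 = y i 0 / x i 0 * x i 0 by rewrite divfK // gt_eqF.
have yj j : y i 0 / x i 0 * x j 0 <= y j 0 by rewrite -ler_pdivlMr // imin.
exists i, (y i 0 / x i 0); split => //.
have := @Z_matrix_mulmx_le _ _ A ((y i 0 / x i 0) *: x) y i ZA.
rewrite -scalemxAr !mxE => h; apply: h => [j|]; last by rewrite -yi.
by rewrite mxE.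
Qed.

Lemma Z_matrix_monotone (R : realType) (n : nat) (A : 'M[R]_n.+1)
    (x y : 'cV[R]_n.+1) :
  Z_matrix A -> vlt 0 x -> vlt 0 (A *m x) ->
  (forall i, 0 <= (A *m y) i 0) -> forall i, 0 <= y i 0.
Proof.
move=> ZA x0 Ax0 Ay.
have [i [t [yi yj Ayi]]] := Z_matrix_min_ratio y ZA x0.
have t_ge0 : 0 <= t.
  have := Ax0 i; rewrite mxE => Axi.
  by rewrite -(pmulr_lge0 _ Axi) (le_trans (Ay i)).
move=> j; apply: le_trans (yj j); rewrite mulr_ge0 //.
by have := x0 j; rewrite mxE => /ltW.
Qed.

Lemma Z_matrix_strictly_monotone (R : realType) (n : nat) (A : 'M[R]_n.+1)
    (x y : 'cV[R]_n.+1) :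
  Z_matrix A -> vlt 0 x -> vlt 0 (A *m x) -> vlt 0 (A *m y) -> vlt 0 y.
Proof.
move=> ZA x0 Ax0 Ay.
have [i [t [yi yj Ayi]]] := Z_matrix_min_ratio y ZA x0.
have t_gt0 : 0 < t.
  have := Ax0 i; rewrite mxE => Axi.
  rewrite -(pmulr_lgt0 _ Axi) (lt_le_trans _ Ayi) //.
  by have := Ay i; rewrite [X in X < _]mxE.
move=> j; rewrite mxE; apply: lt_le_trans (yj j); rewrite mulr_gt0 //.
by have := x0 j; rewrite mxE.
Qed.

(** Ground state substitution: with x_i = v_i y_i, symmetry of A gives
    2 x^T A x = 2 sum_i v_i y_i^2 (A v)_i - sum_ij A_ij v_i v_j (y_i - y_j)^2,
    and every summand on the right is nonnegative. *)
Lemma sym_Z_matrix_psd (R : realType) (n : nat) (A : 'M[R]_n.+1)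
    (v x : 'cV[R]_n.+1) :
  Z_matrix A -> A^T = A -> vlt 0 v -> (forall i, 0 <= (A *m v) i 0) ->
  0 <= \sum_i x i 0 * (A *m x) i 0.
Proof.
move=> ZA symA v0 Av.
have v_gt0 j : 0 < v j 0 by have := v0 j; rewrite mxE.
pose y i := x i 0 / v i 0.
have xE i : x i 0 = y i * v i 0 by rewrite divfK // gt_eqF.
pose S := \sum_i \sum_j A i j * v i 0 * v j 0 * y i ^+ 2.
have S_ge0 : 0 <= S.
  apply: sumr_ge0 => i _.
  rewrite (_ : \sum_j _ = v i 0 * y i ^+ 2 * (A *m v) i 0).
    exact: mulr_ge0 (mulr_ge0 (ltW (v_gt0 i)) (sqr_ge0 _)) (Av i).
  by rewrite mxE mulr_sumr; apply: eq_bigr => j _; ring.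
(* Symmetry of A lets the weight sit on either index. *)
have ST : S = \sum_i \sum_j A i j * v i 0 * v j 0 * y j ^+ 2.
  rewrite /S exchange_big; apply: eq_bigr => i _; apply: eq_bigr => j _.
  by rewrite -[A in RHS]symA [in RHS]mxE; ring.
have QE : (\sum_i x i 0 * (A *m x) i 0) *+ 2 = S + S +
    \sum_i \sum_j - (A i j * v i 0 * v j 0 * (y i - y j) ^+ 2).
  rewrite {2}ST /S -!big_split -sumrMnl; apply: eq_bigr => i _ /=.
  rewrite mxE mulr_sumr -!big_split -sumrMnl; apply: eq_bigr => j _ /=.
  by rewrite !xE; ring.
rewrite -(pmulrn_lge0 _ (isT : (0 < 2)%N)) QE !addr_ge0 //.
apply: sumr_ge0 => i _; apply: sumr_ge0 => j _.
have [->|ij] := eqVneq i j; first by rewrite subrr expr0n mulr0 oppr0.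
rewrite oppr_ge0 mulr_le0_ge0 ?sqr_ge0 //.
by rewrite mulr_le0_ge0 ?mulr_le0_ge0 ?ZA // ltW.
Qed.

(** * Newton steps from positive supersolutions *)

Section Newton.
Variables (R : realType) (n : nat) (beta lam : R) (B : 'M[R]_n.+1).
Hypotheses (beta_gt0 : 0 < beta) (ZB : Z_matrix B).
Implicit Types u v x : 'cV[R]_n.+1.

(** Both the Jacobian of the residual and the difference quotients of the
    residual between two vectors are of this form. *)
Definition shifted (d : 'cV[R]_n.+1) : 'M[R]_n.+1 := diagv d + B - lam%:M.

Definition jacobian u : 'M[R]_n.+1 := (3 * beta) *: diagv (vsq u) + B - lam%:M.

Lemma diagv_mulmxE (d x : 'cV[R]_n.+1) i : (diagv d *m x) i 0 = d i 0 * x i 0.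
Proof. by rewrite /diagv mul_diag_mx !mxE. Qed.

Lemma vsqE u i : vsq u i 0 = u i 0 ^+ 2.
Proof. by rewrite mxE. Qed.

Lemma shifted_mulmxE d x i :
  (shifted d *m x) i 0 = d i 0 * x i 0 + (B *m x) i 0 - lam * x i 0.
Proof.
rewrite /shifted mulmxBl mulmxDl mul_scalar_mx -diagv_mulmxE.
by rewrite [LHS]mxE [in X in X + _]mxE [in X in _ + X]mxE [in X in _ + X]mxE.
Qed.

Lemma Z_matrix_shifted d : Z_matrix (shifted d).
Proof.
move=> i j ij; rewrite !mxE (negbTE ij) !mulr0n add0r subr0.
exact: ZB.
Qed.

Lemma residualE u i :
  residual beta B lam u i 0 = beta * u i 0 ^+ 3 + (B *m u) i 0 - lam * u i 0.
Proof.
rewrite /residual; have := diagv_mulmxE (vsq u) u i.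
move: (B *m u) (diagv _ *m u) => Bu Du; rewrite vsqE => Dui.
by rewrite !mxE Dui -exprSr.
Qed.

Lemma jacobianE u : jacobian u = shifted ((3 * beta) *: vsq u).
Proof. by rewrite /jacobian /shifted /diagv !linearZ. Qed.

Lemma jacobian_mulmxE u x i : (jacobian u *m x) i 0 =
  3 * beta * u i 0 ^+ 2 * x i 0 + (B *m x) i 0 - lam * x i 0.
Proof. by rewrite jacobianE shifted_mulmxE !mxE. Qed.

Lemma mulmxB_entry (u v : 'cV[R]_n.+1) i :
  (B *m (u - v)) i 0 = (B *m u) i 0 - (B *m v) i 0.
Proof. by rewrite mulmxBr [LHS]mxE [in X in _ + X]mxE. Qed.

Lemma colB_entry u v i : (u - v) i 0 = u i 0 - v i 0.
Proof. by rewrite !mxE. Qed.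

(** Comparison principle.  The difference f(u) - f(v) equals A (u - v), where A
    adds beta (u^2 + u v + v^2) to the diagonal of B - lam.  This A is monotone,
    for A u = f(u) + beta (u v + v^2) u is positive. *)
Lemma comparison u v :
  vlt 0 u -> vlt 0 v -> (forall i, 0 <= residual beta B lam u i 0) ->
  (forall i, residual beta B lam v i 0 <= 0) ->
  forall i, v i 0 <= u i 0.
Proof.
move=> u0 v0 ru rv.
have u_gt0 j : 0 < u j 0 by have := u0 j; rewrite mxE.
have v_gt0 j : 0 < v j 0 by have := v0 j; rewrite mxE.
pose d := \col_i (beta * (u i 0 ^+ 2 + u i 0 * v i 0 + v i 0 ^+ 2)).
have dE i : d i 0 = beta * (u i 0 ^+ 2 + u i 0 * v i 0 + v i 0 ^+ 2).
  by rewrite mxE.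
suff vu : forall i, 0 <= (u - v) i 0.
  by move=> i; have := vu i; rewrite !mxE subr_ge0.
apply: (@Z_matrix_monotone _ _ (shifted d) u); [exact: Z_matrix_shifted|by []| |].
- move=> i; rewrite [X in X < _]mxE shifted_mulmxE dE.
  have -> : beta * (u i 0 ^+ 2 + u i 0 * v i 0 + v i 0 ^+ 2) * u i 0 +
      (B *m u) i 0 - lam * u i 0 = residual beta B lam u i 0 +
      beta * (u i 0 * v i 0 + v i 0 ^+ 2) * u i 0 by rewrite residualE; ring.
  by rewrite ltr_wpDl // !(mulr_gt0, addr_gt0, exprn_gt0).
- move=> i; rewrite shifted_mulmxE mulmxB_entry dE colB_entry.
  have := ru i; have := rv i; rewrite !residualE => rvi rui.
  rewrite -subr_le0 in rvi.
  nra.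
Qed.

Section Step.
Variables u u' : 'cV[R]_n.+1.
Hypothesis newton_step :
  jacobian u *m u' = (2 * beta) *: (diagv (vsq u) *m u).

Lemma newton_stepE i :
  3 * beta * u i 0 ^+ 2 * u' i 0 + (B *m u') i 0 - lam * u' i 0 =
  2 * beta * u i 0 ^+ 3.
Proof.
rewrite -jacobian_mulmxE newton_step [LHS]mxE diagv_mulmxE vsqE.
by rewrite -exprSr.
Qed.

Lemma newton_increment : jacobian u *m (u - u') = residual beta B lam u.
Proof.
apply/colP => i; rewrite jacobian_mulmxE residualE mulmxB_entry colB_entry.
have := newton_stepE i; lra.
Qed.

(** The Taylor expansion of the cubic residual at u, whose first-order part is
    cancelled by the Newton step. *)
Lemma newton_residual i : residual beta B lam u' i 0 =
  beta * (u i 0 - u' i 0) ^+ 2 * (2 * u i 0 + u' i 0).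
Proof. by rewrite residualE; have := newton_stepE i; lra. Qed.

Hypotheses (u0 : vlt 0 u) (ru : forall i, 0 <= residual beta B lam u i 0).

(** A positive supersolution is thus itself a witness that the Jacobian at it
    is monotone. *)
Lemma jacobian_mul_gt0 : vlt 0 (jacobian u *m u).
Proof.
move=> i; rewrite mxE jacobian_mulmxE.
have u_gt0 : 0 < u i 0 by have := u0 i; rewrite mxE.
have -> : 3 * beta * u i 0 ^+ 2 * u i 0 + (B *m u) i 0 - lam * u i 0 =
  residual beta B lam u i 0 + 2 * beta * u i 0 ^+ 3 by rewrite residualE; ring.
by rewrite ltr_wpDl // !(mulr_gt0, exprn_gt0).
Qed.

Lemma newton_step_gt0 : vlt 0 u'.
Proof.
apply: (@Z_matrix_strictly_monotone _ _ (jacobian u) u) => //.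
- by rewrite jacobianE; exact: Z_matrix_shifted.
- exact: jacobian_mul_gt0.
- move=> i; rewrite newton_step mxE [X in _ < X]mxE diagv_mulmxE vsqE.
  have u_gt0 : 0 < u i 0 by have := u0 i; rewrite mxE.
  by rewrite !(mulr_gt0, exprn_gt0).
Qed.

Lemma newton_step_le i : u' i 0 <= u i 0.
Proof.
suff h : forall i, 0 <= (u - u') i 0 by have := h i; rewrite !mxE subr_ge0.
apply: (@Z_matrix_monotone _ _ (jacobian u) u) => //.
- by rewrite jacobianE; exact: Z_matrix_shifted.
- exact: jacobian_mul_gt0.
- by move=> j; rewrite newton_increment.
Qed.

Lemma newton_step_residual_ge0 i : 0 <= residual beta B lam u' i 0.
Proof.
have u_gt0 : 0 < u i 0 by have := u0 i; rewrite mxE.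
have u'_gt0 : 0 < u' i 0 by have := newton_step_gt0 i; rewrite mxE.
rewrite newton_residual mulr_ge0 ?(mulr_ge0 (ltW beta_gt0)) ?sqr_ge0 //; lra.
Qed.

End Step.

Lemma newton_seq_invariant u0 U :
  newton_seq beta B lam u0 U -> vlt 0 u0 ->
  (forall i, 0 <= residual beta B lam u0 i 0) ->
  forall l, [/\ vlt 0 (U l), forall i, 0 <= residual beta B lam (U l) i 0
    & forall i, U l i 0 <= u0 i 0].
Proof.
move=> [<- step] U0_gt0 rU0; elim=> [|l [Ul_gt0 rUl Ul_le]]; first by split.
split; first exact: newton_step_gt0 (step l) Ul_gt0 rUl.
  exact: newton_step_residual_ge0 (step l) Ul_gt0 rUl.
by move=> i; apply: le_trans (Ul_le i); exact: newton_step_le (step l) _ _ i.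
Qed.

End Newton.

Section NewtonLimit.
Import numFieldNormedType.Exports.
Local Open Scope classical_set_scope.
Variables (R : realType) (n : nat) (beta lam : R) (B : 'M[R]_n.+1).
Variables (u0 w : 'cV[R]_n.+1) (U : nat -> 'cV[R]_n.+1).
Hypotheses (newtonU : newton_seq beta B lam u0 U)
  (Uw : U l @[l --> \oo] --> w).

Lemma newton_limit_entry i : U l i 0 @[l --> \oo] --> w i 0.
Proof.
apply: (@cvg_comp _ _ _ U (fun M : 'cV[R]_n.+1 => M i 0)); first exact: Uw.
exact: coord_continuous.
Qed.

Lemma newton_limit_ge (v : 'cV[R]_n.+1) :
  (forall l i, v i 0 <= U l i 0) -> forall i, v i 0 <= w i 0.
Proof.
move=> vU i.
rewrite -(cvg_lim (@Rhausdorff R) (newton_limit_entry (i := i))).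
by apply: limr_ge; [exact: cvgP (@newton_limit_entry i)|exact: nearW].
Qed.

(** By newton_residual the residual of an iterate is controlled by the last
    increment, which tends to 0. *)
Lemma newton_limit_residual : residual beta B lam w = 0.
Proof.
apply/colP => i; rewrite [RHS]mxE.
have shiftU j : U l.+1 j 0 @[l --> \oo] --> w j 0.
  by have := @newton_limit_entry j; rewrite -cvg_shiftS.
have lim_res : residual beta B lam (U l.+1) i 0 @[l --> \oo]
    --> residual beta B lam w i 0.
  under eq_fun do rewrite residualE mxE.
  rewrite residualE mxE; apply: cvgB.
    apply: cvgD.
      apply: cvgMl_tmp; under eq_fun do rewrite 2!exprS expr1.
      by rewrite 2!exprS expr1; do 2 apply: cvgM => //.
    apply: cvg_big => [|j _]; first exact: add_continuous.
    exact: cvgMl_tmp.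
  exact: cvgMl_tmp.
have lim_0 : residual beta B lam (U l.+1) i 0 @[l --> \oo] --> (0 : R).
  case: newtonU => _ step.
  under eq_fun do rewrite (newton_residual (step _)) expr2.
  have -> : (0 : R) = beta * ((w i 0 - w i 0) * (w i 0 - w i 0)) *
    (2 * w i 0 + w i 0) by ring.
  have U_i := @newton_limit_entry i.
  apply: cvgM; last by apply: cvgD => //; exact: cvgMl_tmp.
  by apply: cvgMl_tmp; apply: cvgM; apply: cvgB.
exact: (cvg_unique (@Rhausdorff R) lim_res lim_0).
Qed.

End NewtonLimit.

(** * Quadratic decay of the residual *)

Section Norms.
Variables (R : realType).

Lemma sum_sqr_le_sqr_sum (I : finType) (a : I -> R) :
  (forall i, 0 <= a i) -> \sum_i a i ^+ 2 <= (\sum_i a i) ^+ 2.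
Proof.
move=> a_ge0; rewrite expr2 mulr_suml; apply: ler_sum => i _.
rewrite expr2 ler_wpM2l // (bigD1 i) //= lerDl.
by apply: sumr_ge0 => j _.
Qed.

(** If y = A x with A >= c I, then |y| >= c |x|.  Expanding the sum of the
    squares of y - c x replaces Cauchy-Schwarz. *)
Lemma coercive_sqr_le (I : finType) (c : R) (x y : I -> R) : 0 < c ->
  c * (\sum_i x i ^+ 2) <= \sum_i x i * y i ->
  c ^+ 2 * (\sum_i x i ^+ 2) <= \sum_i y i ^+ 2.
Proof.
move=> c_gt0 coer.
have : 0 <= \sum_i (y i - c * x i) ^+ 2 by apply: sumr_ge0 => i _; exact: sqr_ge0.
have -> : \sum_i (y i - c * x i) ^+ 2 = \sum_i y i ^+ 2 -
    2 * c * (\sum_i x i * y i) + c ^+ 2 * (\sum_i x i ^+ 2).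
  rewrite !mulr_sumr -sumrB -big_split; apply: eq_bigr => i _ /=; ring.
have : c * (c * (\sum_i x i ^+ 2)) <= c * (\sum_i x i * y i).
  by rewrite ler_wpM2l // ltW.
by rewrite mulrA -expr2; lra.
Qed.

Variable n : nat.
Implicit Types u : 'cV[R]_n.+1.

Lemma norm2_sqr u : norm2 u ^+ 2 = \sum_i u i 0 ^+ 2.
Proof. by rewrite sqr_sqrtr // sumr_ge0 // => i _; exact: sqr_ge0. Qed.

Lemma norm2_le u (c : R) : 0 <= c -> \sum_i u i 0 ^+ 2 <= c ^+ 2 -> norm2 u <= c.
Proof.
by move=> c_ge0 h; rewrite -[c]ger0_norm // -sqrtr_sqr ler_wsqrtr.
Qed.

Lemma vmin_le u i : vmin u <= u i 0.
Proof. exact: bigmin_le. Qed.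

Lemma vmax_ge u i : u i 0 <= vmax u.
Proof. exact: (le_bigmax _ (fun j => u j 0) i). Qed.

Lemma vmin_gt0 u : vlt 0 u -> 0 < vmin u.
Proof.
move=> u_gt0; apply: lt_bigmin => [|i _].
  by have := u_gt0 ord0; rewrite mxE.
by have := u_gt0 i; rewrite mxE.
Qed.

End Norms.

Section Quadratic.
Variables (R : realType) (n : nat) (beta lam : R) (B : 'M[R]_n.+1).
Hypotheses (beta_gt0 : 0 < beta) (ZB : Z_matrix B) (symB : B^T = B).
Variable us : 'cV[R]_n.+1.
Hypotheses (us_gt0 : vlt 0 us) (rus : residual beta B lam us = 0).

(** The Jacobian at u exceeds the positive semidefinite matrix
    beta diag(us^2) + B - lam by the diagonal of beta (3 u^2 - us^2). *)
Lemma jacobian_coercive (u x : 'cV[R]_n.+1) : (forall i, us i 0 <= u i 0) ->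
  2 * beta * vmin us ^+ 2 * (\sum_i x i 0 ^+ 2) <=
  \sum_i x i 0 * (jacobian beta lam B u *m x) i 0.
Proof.
move=> us_u.
pose A := shifted lam B (beta *: vsq us).
have AE (y : 'cV[R]_n.+1) i : (A *m y) i 0 =
    beta * us i 0 ^+ 2 * y i 0 + (B *m y) i 0 - lam * y i 0.
  by rewrite /A shifted_mulmxE [in X in X * _ + _]mxE vsqE.
have symA : A^T = A.
  by rewrite /A /shifted /diagv linearB linearD /= tr_diag_mx tr_scalar_mx symB.
have A_us i : 0 <= (A *m us) i 0.
  have := congr1 (fun v : 'cV_n.+1 => v i 0) rus.
  by rewrite AE residualE [RHS]mxE -mulrA -exprSr => ->.
have := sym_Z_matrix_psd x (Z_matrix_shifted lam ZB _) symA us_gt0 A_us.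
move=> psd; rewrite -subr_ge0; apply: le_trans psd _.
rewrite mulr_sumr -sumrB; apply: ler_sum => i _.
rewrite AE jacobian_mulmxE.
have m_gt0 := vmin_gt0 us_gt0; have m_le := vmin_le us i.
have us2 : us i 0 ^+ 2 <= u i 0 ^+ 2.
  by rewrite ler_sqr ?nnegrE // (le_trans (ltW m_gt0)) // (le_trans m_le).
have m2 : vmin us ^+ 2 <= us i 0 ^+ 2.
  by rewrite ler_sqr ?nnegrE ?(le_trans (ltW m_gt0)) // ltW.
have : 0 <= beta * x i 0 ^+ 2 *
    (3 * u i 0 ^+ 2 - us i 0 ^+ 2 - 2 * vmin us ^+ 2).
  apply: mulr_ge0; [exact: mulr_ge0 (ltW beta_gt0) (sqr_ge0 _)|lra].
lra.
Qed.

Lemma newton_residual_quadratic (u u' : 'cV[R]_n.+1) (K : R) :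
  jacobian beta lam B u *m u' = (2 * beta) *: (diagv (vsq u) *m u) ->
  (forall i, us i 0 <= u i 0) -> vlt 0 u' ->
  (forall i, u i 0 <= K) -> (forall i, u' i 0 <= K) ->
  norm2 (residual beta B lam u') <=
  6 * beta * K / (8 * beta ^+ 2 * vmin us ^+ 4)
    * norm2 (residual beta B lam u) ^+ 2.
Proof.
move=> step us_u u'_gt0 uK u'K.
have m_gt0 := vmin_gt0 us_gt0.
have u_gt0 i : 0 < u i 0.
  by apply: lt_le_trans (us_u i); have := us_gt0 i; rewrite mxE.
have K_ge0 : 0 <= K := le_trans (ltW (u_gt0 ord0)) (uK ord0).
pose d := u - u'; pose N := \sum_i d i 0 ^+ 2.
have N_ge0 : 0 <= N by apply: sumr_ge0 => i _; exact: sqr_ge0.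
have r'_le : norm2 (residual beta B lam u') <= 3 * beta * K * N.
  have C_ge0 : 0 <= 3 * beta * K by rewrite mulr_ge0 // mulr_ge0 // ltW.
  apply: norm2_le; first exact: mulr_ge0.
  apply: (@le_trans _ _ (\sum_i (3 * beta * K) ^+ 2 * (d i 0 ^+ 2) ^+ 2)).
    apply: ler_sum => i _; rewrite -exprMn.
    have u'i : 0 < u' i 0 by have := u'_gt0 i; rewrite mxE.
    have r'_eq := newton_residual step i.
    have d_eq : d i 0 = u i 0 - u' i 0 by rewrite colB_entry.
    have bd_ge0 : 0 <= beta * d i 0 ^+ 2 by rewrite mulr_ge0 ?sqr_ge0 ?ltW.
    rewrite r'_eq -d_eq ler_sqr ?nnegrE.
    - have -> : 3 * beta * K * d i 0 ^+ 2 = beta * d i 0 ^+ 2 * (3 * K) by ring.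
      rewrite ler_wpM2l //; have := uK i; have := u'K i; lra.
    - by rewrite mulr_ge0 //; have := u_gt0 i; lra.
    - exact: mulr_ge0 C_ge0 (sqr_ge0 _).
  rewrite -mulr_sumr [leRHS]exprMn ler_wpM2l ?sqr_ge0 //.
  by apply: sum_sqr_le_sqr_sum => i; exact: sqr_ge0.
have N_le : 4 * beta ^+ 2 * vmin us ^+ 4 * N <=
    norm2 (residual beta B lam u) ^+ 2.
  have -> : 4 * beta ^+ 2 * vmin us ^+ 4 = (2 * beta * vmin us ^+ 2) ^+ 2.
    by ring.
  rewrite norm2_sqr -(newton_increment step); apply: coercive_sqr_le.
    by rewrite !mulr_gt0 // exprn_gt0.
  exact: jacobian_coercive.
have D_gt0 : 0 < 8 * beta ^+ 2 * vmin us ^+ 4.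
  by rewrite !mulr_gt0 // exprn_gt0.
rewrite mulrAC ler_pdivlMr //.
apply: (@le_trans _ _ (3 * beta * K * N * (8 * beta ^+ 2 * vmin us ^+ 4))).
  by rewrite ler_wpM2r // ltW.
have -> : 3 * beta * K * N * (8 * beta ^+ 2 * vmin us ^+ 4) =
  6 * beta * K * (4 * beta ^+ 2 * vmin us ^+ 4 * N) by ring.
by rewrite ler_wpM2l // mulr_ge0 // mulr_ge0 // ltW.
Qed.

End Quadratic.

(** * Existence of the positive solution *)

Section Existence.
Import numFieldNormedType.Exports.
Variables (R : realType) (n : nat) (beta : R) (B : 'M[R]_n.+1).
Hypotheses (beta_gt0 : 0 < beta) (ZB : Z_matrix B).

Lemma positive_solutionE lam (u : 'cV[R]_n.+1) :
  positive_solution beta B lam u <-> vlt 0 u /\ residual beta B lam u = 0.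
Proof.
by split=> -[u0 e]; split => //; [rewrite /residual e subrr
  | apply/eqP; rewrite -subr_eq0; apply/eqP].
Qed.

(** Along the ray of a positive eigenvector p, and for lam > mu, the sign of
    the residual is explicit: large positive multiples are supersolutions and
    small ones subsolutions. *)
Lemma eigen_residualE lam mu (p : 'cV[R]_n.+1) c i : B *m p = mu *: p ->
  residual beta B lam (c *: p) i 0 =
  c * p i 0 * (beta * (c * p i 0) ^+ 2 - (lam - mu)).
Proof.
by move=> Bp; rewrite residualE -scalemxAr Bp !mxE; ring.
Qed.

Lemma eigen_subsolution lam mu (p : 'cV[R]_n.+1) :
  vlt 0 p -> B *m p = mu *: p -> mu < lam ->
  exists v, vlt 0 v /\ forall i, residual beta B lam v i 0 <= 0.
Proof.
move=> p0 Bp mu_lam.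
have p_gt0 i : 0 < p i 0 by have := p0 i; rewrite mxE.
have P_gt0 : 0 < vmax p := lt_le_trans (p_gt0 ord0) (vmax_ge p ord0).
(* The largest c with beta (c p_i)^2 <= lam - mu for all i. *)
pose c := Num.sqrt ((lam - mu) / beta) / vmax p.
have q_gt0 : 0 < (lam - mu) / beta by rewrite divr_gt0 // subr_gt0.
have c_gt0 : 0 < c by rewrite divr_gt0 // sqrtr_gt0.
exists (c *: p); split=> i; first by rewrite [X in X < _]mxE mxE mulr_gt0.
rewrite (eigen_residualE lam c i Bp) mulr_ge0_le0 //.
  by rewrite ltW // mulr_gt0.
rewrite subr_le0 mulrC -ler_pdivlMr //.
rewrite -[leRHS]sqr_sqrtr; last exact: ltW.
have cp_le : c * p i 0 <= Num.sqrt ((lam - mu) / beta).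
  by rewrite /c mulrAC ler_pdivrMr // ler_wpM2l ?sqrtr_ge0 // vmax_ge.
by rewrite ler_sqr ?nnegrE ?sqrtr_ge0 // ltW // mulr_gt0.
Qed.

(** The limit of a Newton sequence supplies a positive solution, which is what
    makes the choice operator in pos_sol return one. *)
Lemma pos_sol_positive lam mu (p u0 w : 'cV[R]_n.+1) U :
  vlt 0 p -> B *m p = mu *: p -> mu < lam ->
  newton_seq beta B lam u0 U -> (U l @[l --> \oo] --> w)%classic ->
  vlt 0 u0 -> (forall i, 0 <= residual beta B lam u0 i 0) ->
  positive_solution beta B lam (pos_sol beta B lam).
Proof.
move=> p0 Bp mu_lam newtonU Uw u0_gt0 ru0.
apply: xgetPex; exists w; apply/positive_solutionE.
split; last exact: newton_limit_residual newtonU Uw.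
have [v [v_gt0 rv]] := eigen_subsolution p0 Bp mu_lam.
have vw : forall i, v i 0 <= w i 0.
  apply: (newton_limit_ge Uw) => l.
  have [Ul rUl _] := newton_seq_invariant beta_gt0 ZB newtonU u0_gt0 ru0 l.
  exact: (comparison beta_gt0 ZB Ul v_gt0 rUl rv).
by move=> i; apply: lt_le_trans (v_gt0 i) (vw i).
Qed.

End Existence.

Lemma bisection_bounds (R : realType) (n : nat) (beta : R) (B : 'M[R]_n.+1)
    u0 a b left right lam U w :
  newton_bisection beta B u0 a b left right lam U w -> a < b ->
  forall k, a < lam k /\ lam k < b.
Proof.
case=> -[left0 right0] lamE _ _ step ab.
suff inv k : [/\ a <= left k, left k < right k & right k <= b].
  by move=> k; have [] := inv k; rewrite lamE; lra.
elim: k => [|k [al lr rb]]; first by rewrite left0 right0.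
have := lamE k; have := step k.
by case: ifP => _ [-> ->] ->; split; lra.
Qed.

Theorem theorem5 (R : realType) (n : nat) (beta : R) (B : 'M[R]_n.+1)
    (beta_gt0 : 0 < beta) (B_sym : B^T = B) (B_irr : irreducible_mx B)
    (B_nonsing : B \in unitmx) (B_M : M_matrix B) :
  exists M1 : 'cV[R]_n.+1 -> 'cV[R]_n.+1 -> R,
  forall (a b lam_star : R) (u_star : 'cV[R]_n.+1),
    positive_eigenpair beta B u_star lam_star ->
    lambda_min B < a -> a < lam_star -> lam_star < b ->
  forall (p : 'cV[R]_n.+1) (alpha : R),
    vlt 0 p -> B *m p = lambda_min B *: p -> 0 < alpha ->
    let u0 := alpha *: p in
    vlt (pos_sol beta B b) u0 ->
    b - lambda_min B < vmin (\col_i (beta * (alpha * p i 0) ^+ 2)) ->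
  forall (left right lam : nat -> R) (U : nat -> nat -> 'cV[R]_n.+1)
         (w : nat -> 'cV[R]_n.+1),
    newton_bisection beta B u0 a b left right lam U w ->
  forall k : nat,
    let us := pos_sol beta B (lam k) in
    let M := M1 u0 us in
    let eta := 4 * beta ^+ 2 * vmin us ^+ 4 / M in
    let l0 : int :=
      Num.ceil ((lambda_max B + 3 * beta * vmax (vsq u0) - lam k)
                * norm1 (u0 - us) / eta) in
    0 < M /\
    forall l : nat, l0 < l%:Z ->
      norm2 (residual beta B (lam k) (U k l.+1))
      <= M / (8 * beta ^+ 2 * vmin us ^+ 4)
         * norm2 (residual beta B (lam k) (U k l)) ^+ 2.
Proof.
(* 6 beta max(u0) bounds the Lipschitz constant of the Jacobian on [0, u0]. *)
exists (fun u0 _ => 6 * beta * vmax u0).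
move=> a b lam_star u_star _ mu_a a_star star_b p alpha p0 Bp alpha_gt0 u0 _ big.
move=> left right lam U w run k us M eta l0.
have ZB := Z_matrix_of_M_matrix B_M.
have p_gt0 i : 0 < p i 0 by have := p0 i; rewrite mxE.
have u0_gt0 : vlt 0 u0 by move=> i; rewrite !mxE mulr_gt0.
have [a_lam lam_b] := bisection_bounds run (lt_trans a_star star_b) k.
case: run => _ _ newtonU Uw _.
have ru0 i : 0 <= residual beta B (lam k) u0 i 0.
  rewrite (eigen_residualE beta (lam k) alpha i Bp) mulr_ge0 //.
    by rewrite ltW // mulr_gt0.
  have := vmin_le (\col_i (beta * (alpha * p i 0) ^+ 2)) i.
  rewrite mxE; lra.
have /positive_solutionE[us_gt0 rus] :
    positive_solution beta B (lam k) (pos_sol beta B (lam k)).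
  exact: (pos_sol_positive beta_gt0 ZB p0 Bp (lt_trans mu_a a_lam) (newtonU k) (Uw k)).
have inv := newton_seq_invariant beta_gt0 ZB (newtonU k) u0_gt0 ru0.
have u0_pos i : 0 < u0 i 0 by have := u0_gt0 i; rewrite mxE.
split.
  by rewrite !mulr_gt0 // (lt_le_trans (u0_pos ord0)) ?vmax_ge.
move=> l _.
have [Ul_gt0 rUl Ul_le] := inv l; have [Ul1_gt0 _ Ul1_le] := inv l.+1.
apply: (newton_residual_quadratic beta_gt0 ZB B_sym us_gt0 rus).
- by case: (newtonU k) => _; apply.
- apply: (comparison beta_gt0 ZB Ul_gt0 us_gt0 rUl) => i.
  by rewrite rus mxE.
- exact: Ul1_gt0.
- by move=> i; apply: le_trans (Ul_le i) (vmax_ge _ _).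
- by move=> i; apply: le_trans (Ul1_le i) (vmax_ge _ _).
Qed.
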